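(* The collection of injective continuous maps in $\mathrm{ExtrDisc}$ does not form an admissibility structure on $\mathrm{ExtrDisc}$.
   Context: An extremally disconnected space is a compact Hausdorff space in which the closure of every open set is open. $\mathrm{ExtrDisc}$ is the category of extremally disconnected spaces and continuous maps. An admissibility structure on a category $\mathscr{C}$ is a collection of morphisms of $\mathscr{C}$, called admissible, such that: (a) equivalences (isomorphisms) are admissible; (b) if $f \colon U \to X$ is admissible and $g \colon X' \to X$ is any map in $\mathscr{C}$, then the pullback $U \times_X X'$ exists in $\mathscr{C}$ and the projection $U \times_X X' \to X'$ is admissible; (c) for every commuting triangle $h = g \circ f$ in $\mathscr{C}$ with $g$ admissible, $f$ is admissible if and only if $h$ is admissible; (d) admissible morphisms are closed under retracts in the arrow category $\mathrm{Fun}([1], \mathscr{C})$. *)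

(* Defs.v *)
From HB Require Import structures.
From mathcomp Require Import all_boot.
From mathcomp Require Import boolp classical_sets topology.

Set Implicit Arguments.
Unset Strict Implicit.
Unset Printing Implicit Defensive.

Local Open Scope classical_set_scope.

Record category := Category {
  obj :> Type;
  hom : obj -> obj -> Type;
  idm : forall X, hom X X;
  comp : forall X Y Z, hom Y Z -> hom X Y -> hom X Z;
  comp1m : forall X Y (f : hom X Y), comp (idm Y) f = f;
  compm1 : forall X Y (f : hom X Y), comp f (idm X) = f;
  compA : forall X Y Z W (h : hom Z W) (g : hom Y Z) (f : hom X Y),
    comp h (comp g f) = comp (comp h g) f }.

Arguments hom {c} X Y.
Arguments idm {c} X.
Arguments comp {c X Y Z} g f.
Notation "g \oc f" := (comp g f) (at level 40, left associativity).

Definition is_iso (C : category) (X Y : C) (f : hom X Y) : Prop :=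
  exists g : hom Y X, g \oc f = idm X /\ f \oc g = idm Y.

Definition is_pullback (C : category) (U X X' P : C)
    (f : hom U X) (g : hom X' X) (p : hom P U) (q : hom P X') : Prop :=
  f \oc p = g \oc q /\
  forall (W : C) (a : hom W U) (b : hom W X'), f \oc a = g \oc b ->
    exists! u : hom W P, p \oc u = a /\ q \oc u = b.

Definition is_retract_of (C : category) (X Y : C) : Prop :=
  exists (i : hom X Y) (r : hom Y X), r \oc i = idm X.

Section ArrowCategory.
Variable C : category.

Record arrow := Arrow { src : C; tgt : C; arr : hom src tgt }.

Definition arrow_hom (f g : arrow) : Type :=
  { s : hom (src f) (src g) * hom (tgt f) (tgt g) |
    arr g \oc s.1 = s.2 \oc arr f }.

Lemma arrow_hom_eq (f g : arrow) (s t : arrow_hom f g) :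
  sval s = sval t -> s = t.
Proof.
by case: s t => [s hs] [t ht] /= st; subst t; rewrite (Prop_irrelevance hs ht).
Qed.

Lemma arrow_id_comm (f : arrow) :
  arr f \oc (idm (src f), idm (tgt f)).1
  = (idm (src f), idm (tgt f)).2 \oc arr f.
Proof. by rewrite /= comp1m compm1. Qed.

Definition arrow_id (f : arrow) : arrow_hom f f :=
  exist _ (idm (src f), idm (tgt f)) (arrow_id_comm f).

Lemma arrow_comp_comm (f g h : arrow) (t : arrow_hom g h) (s : arrow_hom f g) :
  let st := ((sval t).1 \oc (sval s).1, (sval t).2 \oc (sval s).2) in
  arr h \oc st.1 = st.2 \oc arr f.
Proof.
by case: t s => [t ht] [s hs] /=; rewrite compA ht -compA hs compA.
Qed.

Definition arrow_comp (f g h : arrow)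
    (t : arrow_hom g h) (s : arrow_hom f g) : arrow_hom f h :=
  exist _ ((sval t).1 \oc (sval s).1, (sval t).2 \oc (sval s).2)
    (arrow_comp_comm t s).

Lemma arrow_comp1m (f g : arrow) (s : arrow_hom f g) :
  arrow_comp (arrow_id g) s = s.
Proof. by apply: arrow_hom_eq; case: s => -[a b] ? /=; rewrite !comp1m. Qed.

Lemma arrow_compm1 (f g : arrow) (s : arrow_hom f g) :
  arrow_comp s (arrow_id f) = s.
Proof. by apply: arrow_hom_eq; case: s => -[a b] ? /=; rewrite !compm1. Qed.

Lemma arrow_compA (f g h k : arrow) (u : arrow_hom h k) (t : arrow_hom g h)
    (s : arrow_hom f g) :
  arrow_comp u (arrow_comp t s) = arrow_comp (arrow_comp u t) s.
Proof. by apply: arrow_hom_eq; rewrite /= !compA. Qed.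

Definition arrow_category : category :=
  Category arrow_comp1m arrow_compm1 arrow_compA.

End ArrowCategory.

Record is_admissibility_structure (C : category)
    (adm : forall X Y : C, hom X Y -> Prop) : Prop := IsAdmissibilityStructure {
  adm_iso : forall (X Y : C) (f : hom X Y), is_iso f -> adm X Y f;
  (* In the presence of adm_iso and adm_triangle it does not matter whether the
     projection is admissible for one or for all pullback squares. *)
  adm_pullback : forall (U X X' : C) (f : hom U X) (g : hom X' X),
    adm U X f ->
    exists (P : C) (p : hom P U) (q : hom P X'),
      is_pullback f g p q /\ adm P X' q;
  adm_triangle : forall (X Y Z : C) (f : hom X Y) (g : hom Y Z) (h : hom X Z),
    h = g \oc f -> adm Y Z g -> (adm X Y f <-> adm X Z h);
  adm_retract : forall f g : arrow_category C,
    is_retract_of f g ->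
    adm (src g) (tgt g) (arr g) -> adm (src f) (tgt f) (arr f) }.

Arguments is_admissibility_structure C adm : clear implicits.

Definition extremally_disconnected (T : topologicalType) : Prop :=
  [/\ compact [set: T], hausdorff_space T &
      forall U : set T, open U -> open (closure U)].

Record extrDiscType := ExtrDiscType {
  ed_space :> topologicalType;
  ed_prop : extremally_disconnected ed_space }.

Definition ed_hom (X Y : extrDiscType) : Type := continuousType X Y.

Definition ed_id (X : extrDiscType) : ed_hom X X :=
  (idfun : continuousType X X).

Definition ed_comp (X Y Z : extrDiscType) (g : ed_hom Y Z) (f : ed_hom X Y) :
    ed_hom X Z :=
  ((g : continuousType Y Z) \o (f : continuousType X Y) : continuousType X Z).

Lemma ed_comp1m (X Y : extrDiscType) (f : ed_hom X Y) :
  ed_comp (ed_id Y) f = f.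
Proof. exact/continuousEP. Qed.

Lemma ed_compm1 (X Y : extrDiscType) (f : ed_hom X Y) :
  ed_comp f (ed_id X) = f.
Proof. exact/continuousEP. Qed.

Lemma ed_compA (X Y Z W : extrDiscType) (h : ed_hom Z W) (g : ed_hom Y Z)
    (f : ed_hom X Y) : ed_comp h (ed_comp g f) = ed_comp (ed_comp h g) f.
Proof. exact/continuousEP. Qed.

Definition ExtrDisc : category := Category ed_comp1m ed_compm1 ed_compA.

Definition ed_injective (X Y : ExtrDisc) (f : hom X Y) : Prop :=
  injective (f : continuousType (X : extrDiscType) (Y : extrDiscType)).

(* Main.v *)
(** Writing [beta T] for the space of ultrafilters on [T], let [p] be a
    nonprincipal ultrafilter on [nat] and pull the point [p] of [beta nat] back
    along the map [beta (nat * nat) -> beta nat] induced by the first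
    projection. A pullback [P] would be the fibre over [p], with the subspace
    topology. In [P], consider the open union [V] of the traces of the rows
    [nat * {n}]. If its closure were open, it could be cut out by a set [A] of
    pairs; [A] contains almost all of every row, so selecting in column [s] the
    highest element of [A] of height at most [s] gives a partial section inside
    [A] which, up to [p]-small sets, avoids every row. The image of [p] along
    this section would lie in the closure of [V], but the section defines a
    neighbourhood of it disjoint from [V]. *)
From HB Require Import structures.
From mathcomp Require Import all_boot.
From mathcomp Require Import boolp classical_sets functions filter topology.
Require Import Defs.

Set Implicit Arguments.
Unset Strict Implicit.
Unset Printing Implicit Defensive.

Local Open Scope classical_set_scope.

(** * Complements and images of ultrafilters *)

Lemma ultra_setC T (F : set_system T) (A : set T) :
  UltraFilter F -> F (~` A) <-> ~ F A.
Proof.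
move=> FU; split=> [FnA FA|nFA]; last by case: (in_ultra_setVsetC A FU).
by have /filter_ex[x []] : F (A `&` ~` A) by exact: filterI.
Qed.

Lemma UltraFilter_setC T (F : set_system T) : ProperFilter F ->
  (forall A, F A \/ F (~` A)) -> UltraFilter F.
Proof.
move=> FF FC; split=> // G GF FG; rewrite eqEsubset; split=> // A GA.
have [//|/FG GnA] := FC A.
by have /filter_ex[x []] : G (A `&` ~` A) by exact: filterI.
Qed.

Lemma fmap_ultra T U (f : T -> U) (F : set_system T) :
  UltraFilter F -> UltraFilter (f @ F).
Proof.
move=> FU; apply: UltraFilter_setC => A.
exact: (in_ultra_setVsetC (f @^-1` A)).
Qed.

(** * The extremally disconnected space of ultrafilters on a set *)

Record beta (T : Type) := Beta {
  ultra_sets :> set T -> Prop;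
  ultra_setsP : UltraFilter ultra_sets }.
#[global] Existing Instance ultra_setsP.

Section BetaTopology.
Variable T : Type.
Implicit Types (u v : beta T) (A : set T).

HB.instance Definition _ := gen_eqMixin (beta T).
HB.instance Definition _ := gen_choiceMixin (beta T).

Lemma beta_ext u v : ultra_sets u `<=` ultra_sets v -> u = v.
Proof.
case: u v => [F FU] [G GU] /= FG; have GF : G = F by exact: max_filter.
subst G.
by rewrite (Prop_irrelevance FU GU).
Qed.

Definition beta_basic A : set (beta T) := [set u | ultra_sets u A].

Let beta_open (W : set (beta T)) :=
  forall u, W u -> exists2 A, beta_basic A u & beta_basic A `<=` W.

Let beta_openT : beta_open setT.
Proof. by move=> u _; exists setT => //; exact: filterT. Qed.

Let beta_openI : setI_closed beta_open.
Proof.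
move=> V W oV oW u [/oV[A uA AV] /oW[B uB BW]]; exists (A `&` B).
  exact: filterI.
by move=> v vAB; split; [apply: AV|apply: BW];
  apply: filterS vAB; [exact: subIsetl|exact: subIsetr].
Qed.

Let beta_open_bigU (I : Type) (f : I -> set (beta T)) :
  (forall i, beta_open (f i)) -> beta_open (\bigcup_i f i).
Proof.
move=> fo u [i _ /fo[A uA Af]]; exists A => // v /Af fv; by exists i.
Qed.

HB.instance Definition _ :=
  isOpenTopological.Build (beta T) beta_openT beta_openI beta_open_bigU.

Lemma open_betaP (W : set (beta T)) : open W <->
  forall u, W u -> exists2 A, beta_basic A u & beta_basic A `<=` W.
Proof. by []. Qed.

Lemma nbhs_betaP u (W : set (beta T)) :
  nbhs u W <-> exists2 A, beta_basic A u & beta_basic A `<=` W.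
Proof.
split=> [|[A uA AW]].
  rewrite nbhsE => -[V [oV Vu] VW].
  have [A uA AV] := oV u Vu; exists A => //; exact: subset_trans VW.
rewrite nbhsE; exists (beta_basic A) => //; split=> //.
by move=> v vA; exists A.
Qed.

Lemma open_beta_basic A : open (beta_basic A).
Proof. by move=> u uA; exists A. Qed.

Definition beta_pure (x : T) : beta T := Beta (principal_filter_ultra x).

Lemma beta_pureE x A : beta_pure x A <-> A x.
Proof. exact: principal_filterP. Qed.

(** Principal ultrafilters are dense, so the closure of an open [W] is governed by the points of [T]
    whose principal ultrafilter lies in [W]. This is what makes closures of open sets open. *)
Lemma closure_open_beta (W : set (beta T)) : open W ->
  closure W = beta_basic [set x | W (beta_pure x)].
Proof.
move=> /open_betaP oW; rewrite eqEsubset; split=> u; last first.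
  move=> uW B /nbhs_betaP[A uA AB].
  have /filter_ex[x [Wx Ax]] : ultra_sets u ([set x | W (beta_pure x)] `&` A).
    exact: filterI.
  by exists (beta_pure x); split=> //; apply/AB/beta_pureE.
move=> clu; apply: contrapT => /(ultra_setC _ (ultra_setsP u)) uC.
have /clu[w [/oW[B wB BW] wC]] :
    nbhs u (beta_basic (~` [set x | W (beta_pure x)])).
  by apply/nbhs_betaP; exists (~` [set x | W (beta_pure x)]).
have /filter_ex[x [Bx]] : ultra_sets w (B `&` ~` [set x | W (beta_pure x)]).
  exact: filterI.
by apply; apply: BW; apply/beta_pureE.
Qed.

Lemma compact_beta : compact [set: beta T].
Proof.
rewrite compact_ultra => G GU _.
(* The limit of [G]: a set is large for it when [G]-almost every ultrafilter contains that set. *)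
pose L : set_system T := [set A | G (beta_basic A)].
have LF : Filter L.
  split=> [|A B|A B AB]; rewrite /L /=.
  - by apply: (filterE (F := G)) => u; exact: filterT.
  - by apply: (filterS2 (F := G)) => u; exact: filterI.
  - by apply: (filterS (F := G)) => u; exact: filterS.
have LP : ProperFilter L.
  apply: Build_ProperFilter_ex => A GA; have [u uA] := filter_ex (F := G) GA.
  exact: filter_ex uA.
have LU : UltraFilter L.
  apply: UltraFilter_setC => A.
  have [|GnA] := in_ultra_setVsetC (beta_basic A) GU; first by left.
  by right; apply: filterS GnA => u /(ultra_setC _ (ultra_setsP u)).
exists (Beta LU); split=> // W /nbhs_betaP[A GA AW].
exact: (filterS (F := G) AW).
Qed.

Lemma hausdorff_beta : hausdorff_space (beta T).
Proof.
move=> u v cl; apply: beta_ext => A uA; apply: contrapT => vA.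
have [||w [wA]] := cl (beta_basic A) (beta_basic (~` A)).
- by apply/nbhs_betaP; exists A.
- apply/nbhs_betaP; exists (~` A) => //.
  exact/(ultra_setC _ (ultra_setsP v)).
- by move/(ultra_setC _ (ultra_setsP w)).
Qed.

Lemma extremally_disconnected_beta : extremally_disconnected (beta T).
Proof.
split; [exact: compact_beta|exact: hausdorff_beta|] => W oW.
by rewrite closure_open_beta//; exact: open_beta_basic.
Qed.

(** Normality gives an open [W] around [K] whose closure misses [L], and the closure of an open set
    is basic. *)
Lemma beta_separation (K L : set (beta T)) :
  closed K -> closed L -> K `&` L = set0 ->
  exists2 A, K `<=` beta_basic A & L `<=` beta_basic (~` A).
Proof.
move=> cK cL KL0.
have /(_ (~` L)) := compact_normal hausdorff_beta compact_beta cK.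
case=> [|V KV VL].
  by apply/set_nbhsP; exists (~` L); split; [exact: closed_openC| |];
    last by []; exact/disjoints_subset.
have /set_nbhsP[W [oW KW WV]] := KV.
exists [set x | W (beta_pure x)]; rewrite -?closure_open_beta//.
  by apply: subset_trans KW _; exact: subset_closure.
move=> u Lu; apply/(ultra_setC _ (ultra_setsP u)) => uA.
have : closure W u by rewrite closure_open_beta.
by move=> /(closureS WV)/VL.
Qed.

End BetaTopology.

(** * Maps induced on ultrafilter spaces *)

Section BetaMap.
Variables (S T : Type) (f : S -> T).

Definition beta_map (u : beta S) : beta T :=
  Beta (fmap_ultra f (ultra_setsP u)).

Lemma beta_map_continuous : continuous beta_map.
Proof.
move=> u W /nbhs_betaP[A uA AW]; apply/nbhs_betaP.
by exists (f @^-1` A) => // v vA; exact: AW.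
Qed.

HB.instance Definition _ :=
  isContinuous.Build (beta S) (beta T) beta_map beta_map_continuous.

End BetaMap.

Definition ed_beta (T : Type) : ExtrDisc :=
  ExtrDiscType (@extremally_disconnected_beta T).

(** This makes [beta unit] a one-point space, through which points of other spaces become
    morphisms. *)
Lemma beta_unit_eq (u v : beta unit) : u = v.
Proof.
apply: beta_ext => A uA; have /filter_ex[[] At] := uA.
by apply: filterS (filterT : v setT) => -[].
Qed.

Lemma nonprincipal_ultrafilter :
  exists p : beta nat, forall n, p [set s | (n < s)%N].
Proof.
have [F [FU oF]] := ultraFilterLemma (_ : ProperFilter (\oo : set_system nat)).
by exists (Beta FU) => n; apply: oF; exact: nbhs_infty_gt.
Qed.

(** Bounding heights by [s] makes the maximum exist. In a column without a candidate the claim is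
    vacuous and 0 is a default value. *)
Lemma bounded_max_section (A : set (nat * nat)) :
  exists m : nat -> nat, forall s n, (n <= s)%N -> A (s, n) ->
    (n <= m s)%N /\ A (s, m s).
Proof.
suff /choice[m mP] : forall s, exists k, forall n, (n <= s)%N -> A (s, n) ->
  (n <= k)%N /\ A (s, k) by exists m.
move=> s; pose P n := (n <= s)%N && `[< A (s, n) >].
have [exP|nP] := pselect (exists n, P n); last first.
  by exists 0 => n ns An; case: nP; exists n; rewrite /P ns; exact/asboolP.
have Ps n : P n -> (n <= s)%N by case/andP.
case: (ex_maxnP exP Ps) => k /andP[_ /asboolP Ak] kmax; exists k => n ns An.
by split=> //; apply: kmax; rewrite /P ns; exact/asboolP.
Qed.

(** * The fibre over a nonprincipal ultrafilter *)

Section FibreOfFirstProjection.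
Variables (p : beta nat) (p_nonprincipal : forall n, p [set s | (n < s)%N]).
Variables (P : topologicalType) (q : P -> beta (nat * nat)).
Hypotheses (edP : extremally_disconnected P) (q_cont : continuous q).
Hypotheses (q_inj : injective q) (q_fst : forall x, beta_map fst (q x) = p).
Hypothesis q_onto : forall u, beta_map fst u = p -> exists x, q x = u.

Lemma fibre_not_extremally_disconnected : False.
Proof.
case: edP => cP _ edc.
pose row n : set (nat * nat) := [set z | z.2 = n].
pose V : set P := q @^-1` \bigcup_n beta_basic (row n).
have oV : open V.
  move/continuousP: q_cont; apply.
  by apply: bigcup_open => n _; exact: open_beta_basic.
pose C := closure V.
have oC : open C := edc _ oV.
(* As [P] is compact, [q] is a closed embedding, so [C] and its complement have disjoint closed
   images, which a set [A] of pairs separates. *)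
have closed_q D : closed D -> closed (q @` D).
  move=> cD; apply: compact_closed; first exact: hausdorff_beta.
  apply: continuous_compact.
    by apply: continuous_subspaceT => x; exact: q_cont.
  exact: subclosed_compact cP _.
have [|A CA nCA] := beta_separation (closed_q _ (@closed_closure _ V))
    (closed_q _ (open_closedC oC)).
  rewrite -subset0 => _ [[x Cx <-] [y nCy /q_inj yx]].
  by apply: nCy; rewrite yx.
have A_row n : p [set s | A (s, n)].
  (* Copying [p] onto row [n] gives a point of the fibre inside [V], hence in [C]. *)
  pose u := beta_map (fun s => (s, n)) p.
  have [|x qx] := q_onto (u := u); first exact: beta_ext.
  suff : ultra_sets (q x) A by rewrite qx.
  apply: CA; exists x => //; apply: subset_closure; exists n => //.
  by rewrite /beta_basic /= qx; apply: (filterE (F := ultra_sets p)).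
have [m mP] := bounded_max_section A.
(* For [n < s], height [n.+1] is within the bound [s]; when it lies in [A], the maximum strictly
   exceeds [n]. *)
have m_large n : p [set s | (n < m s)%N /\ A (s, m s)].
  by apply: filterS2 (p_nonprincipal n) (A_row n.+1) => s; exact: mP.
pose u := beta_map (fun s => (s, m s)) p.
have [|x qx] := q_onto (u := u); first exact: beta_ext.
have Cx : C x.
  apply: contrapT => nCx.
  have : ultra_sets (q x) (~` A) by apply: nCA; exists x.
  rewrite qx => /(ultra_setC _ (ultra_setsP u)); apply.
  by apply: filterS (m_large 0) => s [].
(* The graph of [m] cuts out a neighbourhood of [x], so it meets [V] at some [y] in a row [n]. But
   [q y] lies over [p], so [m] exceeds [n] almost everywhere for it. *)
pose section : set (nat * nat) := [set z | z.2 = m z.1].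
have [|y [[n _ yn] ym]] := Cx (q @^-1` beta_basic section).
  apply: q_cont; apply: open_nbhs_nbhs; split; first exact: open_beta_basic.
  by rewrite /beta_basic /= qx; apply: (filterE (F := ultra_sets p)).
have pn : p [set s | (n < m s)%N] by apply: filterS (m_large n) => s [].
have yp : ultra_sets (q y) [set z | (n < m z.1)%N].
  by move: pn; rewrite -{1}(q_fst y).
have /filter_ex[z [[/= zn zm]]] :
  ultra_sets (q y) (row n `&` section `&` [set z | (n < m z.1)%N]).
  by apply: filterI => //; exact: filterI.
by rewrite /= -zm zn ltnn.
Qed.

End FibreOfFirstProjection.

Theorem corollary4p14 : ~ is_admissibility_structure ExtrDisc ed_injective.
Proof.
move=> adm; have [p p_np] := nonprincipal_ultrafilter.
(* The inclusion of the point [p], so that pulling back along [g] produces a fibre. *)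
pose f : @hom ExtrDisc (ed_beta unit) (ed_beta nat) :=
  (cst p : continuousType (beta unit) (beta nat)).
pose g : @hom ExtrDisc (ed_beta (nat * nat)) (ed_beta nat) :=
  (beta_map fst : continuousType (beta (nat * nat)) (beta nat)).
have f_inj : ed_injective f by move=> u v _; exact: beta_unit_eq.
have [P [a [q [[fg univ] q_inj]]]] := adm_pullback adm g f_inj.
have q_cont := @cts_fun _ _ (q : continuousType (P : extrDiscType) _).
apply: (fibre_not_extremally_disconnected p_np (ed_prop P) q_cont q_inj).
  by move=> x; have /continuousEP/(_ x) := fg.
move=> u up.
(* A point of the fibre is a cone with apex [beta unit]; the universal property lifts it to [P]. *)
pose b : @hom ExtrDisc (ed_beta unit) (ed_beta (nat * nat)) :=
  (cst u : continuousType (beta unit) (beta (nat * nat))).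
have [|w [[_ qw] _]] := univ (ed_beta unit) (idm (ed_beta unit)) b.
  by apply/continuousEP => t /=; rewrite up.
by exists ((w : continuousType (beta unit) _) (beta_pure tt));
  have /continuousEP/(_ (beta_pure tt)) := qw.
Qed.
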